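(* $\mathrm{sc}(\{f\in\mathbb{R}^{\mathbb{R}} : f \text{ is Borel}\})\ge\omega_2$.
   Context: A function $f:\mathbb{R}\to\mathbb{R}$ is Borel if it is Borel measurable. $\mathbb{R}^{\mathbb{R}}$ is the set of all functions $f:\mathbb{R}\to\mathbb{R}$. A difference operator is a map $D:\mathbb{R}^{\mathbb{R}}\to\mathbb{R}^{\mathbb{R}}$ of the form $(Df)(x)=\sum_{i=1}^n a_i f(x+b_i)$ with $a_i,b_i\in\mathbb{R}$; $\mathcal{D}$ is the set of difference operators. A system of difference equations is a set $S\subset\mathcal{D}\times\mathbb{R}^{\mathbb{R}}$; a function $f:\mathbb{R}\to\mathbb{R}$ is a solution to $S$ if $Df=g$ for every $(D,g)\in S$. A subsystem of $S$ is a subset of $S$. For $\mathcal{F}\subset\mathbb{R}^{\mathbb{R}}$ the solvability cardinal $\mathrm{sc}(\mathcal{F})$ is the minimal cardinal $\kappa$ with the following property: for every system $S$ of difference equations, if every subsystem of $S$ of cardinality less than $\kappa$ has a solution in $\mathcal{F}$, then $S$ has a solution in $\mathcal{F}$. *)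

(* Defs.v *)
From HB Require Import structures.
From mathcomp Require Import all_boot all_order all_algebra.
From mathcomp Require Import all_classical all_reals all_analysis.

Set Implicit Arguments.
Unset Strict Implicit.
Unset Printing Implicit Defensive.

Import Order.TTheory GRing.Theory Num.Theory.
Import numFieldNormedType.Exports.

Local Open Scope classical_set_scope.
Local Open Scope card_scope.
Local Open Scope ring_scope.

(** Cardinals are represented by types, a type [K] standing for the cardinality
    of [[set: K]]; equality and order of cardinals are [#=] and [#<=]. *)

Definition card_lt T U (A : set T) (B : set U) : Prop :=
  A #<= B /\ A #!= B.

Notation "A '#<' B" := (card_lt A B)
  (at level 79, no associativity) : card_scope.

Lemma inj_card_leT (T U : Type) (f : T -> U) :
  injective f -> [set: T] #<= [set: U].
Proof.
move=> injf; have [g] : $|{inj [set: T] >-> U}|.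
  by apply/injPex; exists f => x y _ _; exact: injf.
by apply: inj_card_le; exact: 'totalfun_[set: T] g.
Qed.

Lemma card_leT_inj (T U : Type) :
  [set: T] #<= [set: U] -> exists f : T -> U, injective f.
Proof.
move=> /card_leP[f].
exists (fun x => val (f (SigSub (mem_set (I : [set: T] x))))) => x y /val_inj.
by move=> /(inj (mem_set I) (mem_set I)) /(congr1 val).
Qed.

Lemma cantor_card_lt (T : Type) : [set: T] #< [set: set T].
Proof.
split.
  by apply: (@inj_card_leT _ _ set1) => x y /seteqP[/(_ x erefl)].
apply/negP; rewrite card_eq_le => /andP[_ /card_leT_inj[f injf]].
pose D : set T := [set x | exists2 A, x = f A & ~ A x].
have [DfD|nDfD] := pselect (D (f D)).
  by have [A /injf <-] := DfD.
by apply: (nDfD); exists D.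
Qed.

Lemma exists_minimal_family (I : Type) (F : I -> Type) : inhabited I ->
  exists i, forall j, [set: F i] #<= [set: F j].
Proof.
move=> [i0]; pose Q (X : set (forall i, F i)) :=
  forall x y, X x -> X y -> forall i, x i = y i -> x = y.
have [X [QX maxX]] : exists X, Q X /\ forall Y, X `<` Y -> ~ Q Y.
  apply: Zorn_bigcup => G GQ Gtot x y [A GA Ax] [B GB By] i.
  by have [AB|BA] := Gtot _ _ GA GB;
    [apply: (GQ _ GB)|apply: (GQ _ GA)] => //; [exact: AB|exact: BA].
have [i iX] : exists i, forall k : F i, exists2 x, X x & x i = k.
  apply: contrapT => noi.
  have noX : forall i, exists k : F i, forall x, X x -> x i <> k.
    move=> i; apply: contrapT => nok; apply: noi; exists i => k.
    apply: contrapT => nox; apply: nok; exists k => x Xx xik.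
    by apply: nox; exists x.
  pose a i := sval (cid (noX i)).
  have aX i x : X x -> x i <> a i := svalP (cid (noX i)) x.
  apply: (maxX (X `|` [set a])).
    split; first by move=> x; left.
    by move=> /(_ a (or_intror erefl)) Xa; exact: (aX i0 _ Xa).
  move=> x y [Xx|->] [Xy|->] i //; first exact: QX.
  - by move=> xa; have := aX i _ Xx.
  - by move=> /esym ya; have := aX i _ Xy.
pose f (k : F i) := s2val (cid2 (iX k)).
have fX k : X (f k) := s2valP (cid2 (iX k)).
have fK k : f k i = k := s2valP' (cid2 (iX k)).
exists i => j; apply: (@inj_card_leT _ _ (fun k => f k j)) => k l.
move=> /(QX _ _ (fX k) (fX l)) fkl.
by rewrite -(fK k) -(fK l) fkl.
Qed.

Lemma card_le_total (T U : Type) :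
  [set: T] #<= [set: U] \/ [set: U] #<= [set: T].
Proof.
have [[] le] :=
  @exists_minimal_family bool (fun b => if b then T else U) (inhabits true).
- by left; exact: (le false).
- by right; exact: (le true).
Qed.

(* A family of types indexed by [Type] is too large for Zorn's lemma, hence the
   detour through the subsets of one member of the family. *)
Lemma exists_minimal_card (P : Type -> Prop) : (exists K, P K) ->
  exists K, P K /\ forall L, P L -> [set: K] #<= [set: L].
Proof.
move=> [K0 PK0].
pose I := {A : set K0 | exists2 L, P L & [set: L] #= A}.
have iT : exists2 L, P L & [set: L] #= [set: K0] by exists K0.
have [i le_i] := @exists_minimal_family I (fun i => set_type (sval i))
  (inhabits (exist _ setT iT)).
have {}le_i (j : I) : sval i #<= sval j.
  have /card_leT_inj[f injf] := le_i j.
  by apply/card_leP/injfunPex; exists f => // x y _ _; exact: injf.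
have [K PK Ki] := svalP i.
have /andP[leKi leiK] : ([set: K] #<= sval i) && (sval i #<= [set: K]).
  by rewrite -card_eq_le.
exists K; split=> // L PL; apply: (card_le_trans leKi).
have [LK0|K0L] := card_le_total L K0.
  have [f injf] := card_leT_inj LK0.
  have eqL : f @` [set: L] #= [set: L].
    by apply: inj_card_eq => x y _ _; exact: injf.
  have iL : exists2 M, P M & [set: M] #= f @` [set: L].
    by exists L => //; exact: card_esym.
  apply: (card_le_trans (le_i (exist _ (f @` [set: L]) iL))).
  exact: card_image_le.
exact: card_le_trans (card_leT _) K0L.
Qed.

Definition min_card (P : Type -> Prop) (exP : exists K, P K) : Type :=
  sval (cid (exists_minimal_card exP)).

Lemma min_cardP (P : Type -> Prop) (exP : exists K, P K) :
  P (min_card exP) /\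
  forall L, P L -> [set: min_card exP] #<= [set: L].
Proof. exact: svalP (cid (exists_minimal_card exP)). Qed.

Definition succ_card (K : Type) : Type :=
  @min_card (fun L => [set: K] #< [set: L])
    (ex_intro _ (set K) (cantor_card_lt K)).

Lemma succ_cardP (K : Type) :
  [set: K] #< [set: succ_card K] /\
  forall L : Type, [set: K] #< [set: L] -> [set: succ_card K] #<= [set: L].
Proof.
exact: (min_cardP
  (ex_intro (fun L => [set: K] #< [set: L]) _ (cantor_card_lt K))).
Qed.

Fixpoint omega (n : nat) : Type :=
  if n is m.+1 then succ_card (omega m) else nat.

Section DifferenceEquations.
Variable R : realType.

Definition difference_operator (D : (R -> R) -> (R -> R)) : Prop :=
  exists (n : nat) (a b : 'I_n -> R),
    forall f x, D f x = \sum_(i < n) a i * f (x + b i).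

Definition equation : Type := ((R -> R) -> (R -> R)) * (R -> R).

Definition difference_system (S : set equation) : Prop :=
  forall e, S e -> difference_operator e.1.

Definition solution (S : set equation) (f : R -> R) : Prop :=
  forall D g, S (D, g) -> D f = g.

Definition solvable_in (F : set (R -> R)) (S : set equation) : Prop :=
  exists2 f, F f & solution S f.

Definition solvability_property (F : set (R -> R)) (K : Type) : Prop :=
  forall S, difference_system S ->
    (forall S', S' `<=` S -> S' #< [set: K] -> solvable_in F S') ->
    solvable_in F S.

Lemma exists_solvability_property (F : set (R -> R)) :
  exists K, solvability_property F K.
Proof.
exists (set equation) => S _; apply; first exact: subset_refl.
have [le_eq /negP neq] := cantor_card_lt equation.
have leS : S #<= [set: equation] := card_leT S.
split; first exact: card_le_trans leS le_eq.
apply/negP; rewrite card_eq_le => /andP[_ leS'].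
apply: neq; rewrite card_eq_le le_eq /=; exact: card_le_trans leS' leS.
Qed.

Definition sc (F : set (R -> R)) : Type :=
  min_card (exists_solvability_property F).

Lemma scP (F : set (R -> R)) :
  solvability_property F (sc F) /\
  forall K, solvability_property F K -> [set: sc F] #<= [set: K].
Proof. exact: min_cardP. Qed.

(** The canonical sigma-algebra on a [realType] is the one generated by the
    half-open intervals, not its Lebesgue completion. *)
Definition borel_fun : set (R -> R) :=
  [set f | measurable_fun [set: R] f].

End DifferenceEquations.

(* Main.v *)
Require Import Defs.
From mathcomp Require Import all_boot all_order all_algebra.
From mathcomp Require Import all_classical all_reals all_analysis.
From mathcomp Require Import measurable_realfun lra zify.

(** It suffices to find a system whose countable subsystems all have Borel
    solutions while the whole system has none: a cardinal [K] with the
    solvability property and [K <= omega 1] would only give access to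
    countable subsystems.

    The system is indexed by the branches [x] of the binary tree.  To every
    branch corresponds a real number [branch_real x], and the equations are
    [f (y + branch_real x) - f y = diagonal x * \1_Y y], where [Y] is a Borel
    group containing all the numbers [branch_real x], and [diagonal x] is
    0 or 1.

    The whole system has no Borel solution, for any choice of the numbers
    [branch_real x]: at [y = 0], a solution [f] satisfies
    [f (branch_real x) - f 0 = diagonal x], and [diagonal] is chosen by
    Cantor's argument.  Borel sets have codes, codes are encoded by branches,
    and if [x] encodes a Borel set [B] then [diagonal x = 1] exactly when
    [branch_real x] is not in [B]; no [B] can then be the set where
    [f - f 0 = 1] ([diagonal_not_borel]).

    Countably many equations have a Borel solution because the numbers
    [branch_real x] are so lacunary that they behave like independent
    generators. Reals are expanded along the sparse powers [2 ^ (k ^ 2)]: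
    every real [y] has digits [digit k y], which are only approximately
    integers, and which are exactly additive in [y] at the large positions
    as long as they do not grow too fast ([digitD]). The positions are the
    nodes of the binary tree, the level [n] being the block [2 ^ n <= k < 2
    ^ n.+1], and the digits of [branch_real x] are 1 along [x] and 0
    elsewhere up to a small error. The group [Y] consists of the reals for
    which the sums of the absolute values of the digits over the blocks are
    bounded. Two branches eventually separate, so that given countably many
    branches there are 0-1 weights on the nodes which, along each of these
    branches [x], are eventually equal to [diagonal x]
    ([branch_interpolation]). The weighted sum of the digits of [y] over the
    block [n] is eventually additive in [y] on [Y], and at [branch_real x]
    it converges to [diagonal x]; hence its limsup over [n] increases by
    [diagonal x] when [y] in [Y] is translated by [branch_real x]
    ([limsup_sumD]). Extended by 0 outside [Y], it is a Borel solution. *)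

Set Implicit Arguments.
Unset Strict Implicit.
Unset Printing Implicit Defensive.

Import Order.TTheory GRing.Theory Num.Theory.
Import numFieldNormedType.Exports.

Local Open Scope classical_set_scope.
Local Open Scope card_scope.
Local Open Scope ring_scope.

(** * The signed distance to the nearest integer *)
Section CenteredFractionalPart.
Context {R : realType}.
Implicit Types (x y : R) (z : int).

Definition cfrac x : R := x - (Num.floor (x + 2^-1))%:~R.

Lemma cfrac_near x z : `|x - z%:~R| < 2^-1 -> cfrac x = x - z%:~R.
Proof.
rewrite ltr_norml => /andP[lo hi]; congr (_ - _%:~R).
by apply: floor_def; rewrite intrD; lra.
Qed.

(** The absolute value of [cfrac x] is the distance from [x] to the integers;
    subadditivity and symmetry follow. *)
Lemma cfrac_le x z : `|cfrac x| <= `|x - z%:~R|.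
Proof.
have [/cfrac_near -> //|far] := ltP `|x - z%:~R| 2^-1.
apply: le_trans far; rewrite ler_norml /cfrac.
by have := floor_itv (x + 2^-1); rewrite intrD; lra.
Qed.

Lemma cfracN_le x : `|cfrac (- x)| <= `|cfrac x|.
Proof.
apply: le_trans (cfrac_le _ (- Num.floor (x + 2^-1))) _.
by rewrite mulrNz -opprD normrN.
Qed.

Lemma cfracD_le x y : `|cfrac (x + y)| <= `|cfrac x| + `|cfrac y|.
Proof.
apply: le_trans (ler_normD _ _).
apply: le_trans (cfrac_le _ (Num.floor (x + 2^-1) + Num.floor (y + 2^-1))) _.
by rewrite intrD /cfrac addrACA opprD.
Qed.

(** Additivity is exact, and not only modulo 1, as long as there is no carry. *)
Lemma cfracD x y : `|cfrac x| + `|cfrac y| < 2^-1 ->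
  cfrac (x + y) = cfrac x + cfrac y.
Proof.
move=> small; rewrite [RHS]addrACA -opprD -intrD; apply: cfrac_near.
rewrite intrD opprD addrACA; exact: le_lt_trans (ler_normD _ _) small.
Qed.

Lemma measurable_cfrac : measurable_fun [set: R] cfrac.
Proof.
apply: measurable_funB; first exact: measurable_id.
apply: nondecreasing_measurable => // x y xy.
by rewrite ler_int le_floor// lerD2r.
Qed.

End CenteredFractionalPart.

(** * Lacunary digits *)
Section Digits.
Context {R : realType}.
Implicit Types (d : nat -> bool) (k n : nat) (y : R).

(** Bases [2 ^ (k ^ 2)] with consecutive quotients [2 ^ (2 k + 1)]: if
    [y = \sum_k d k / 2 ^ (k.+1 ^ 2)], then [2 ^ (k ^ 2) * y] is congruent
    modulo 1 to [d k / 2 ^ (2 k + 1)] plus a much smaller remainder, so that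
    [digit k y] is close to [d k]. *)
Definition digit k y : R := 2 ^+ (2 * k).+1 * cfrac (2 ^+ (k * k) * y).

Lemma digitN_le k y : `|digit k (- y)| <= `|digit k y|.
Proof.
by rewrite !normrM ler_wpM2l// mulrN cfracN_le.
Qed.

Lemma digitD_le k x y : `|digit k (x + y)| <= `|digit k x| + `|digit k y|.
Proof.
by rewrite !normrM -mulrDr ler_wpM2l// mulrDr cfracD_le.
Qed.

(** The rounding of [x] and [y] commutes with their sum when the digits are
    small compared with the quotient [2 ^ (2 k + 1)] of consecutive bases. *)
Lemma digitD k x y : `|digit k x| + `|digit k y| < 4 ^+ k ->
  digit k (x + y) = digit k x + digit k y.
Proof.
move=> small; rewrite /digit (mulrDr (2 ^+ (k * k))) cfracD ?mulrDr//.
set a := cfrac _; set b := cfrac _; set q : R := 2 ^+ (2 * k).+1.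
have qE : q = 2 * 4 ^+ k.
  by rewrite /q exprS exprM; congr (_ * _ ^+ _); lra.
have q0 : 0 < q by rewrite qE mulr_gt0// exprn_gt0.
rewrite -(ltr_pM2l q0); apply: lt_le_trans (_ : 4 ^+ k <= _).
  by move: small; rewrite /digit !normrM -/q -/a -/b (gtr0_norm q0) mulrDr.
by rewrite qE; lra.
Qed.

Lemma measurable_digit k : measurable_fun [set: R] (digit k).
Proof.
apply: measurable_funM => //; apply: measurableT_comp.
  exact: measurable_cfrac.
by apply: measurable_funM.
Qed.

Definition digit_psum d n : R :=
  \sum_(k < n) (d k)%:R / 2 ^+ (k.+1 * k.+1).

Definition digit_sum d : R := sup (range (digit_psum d)).

Lemma digit_psum_ge d m n : (m <= n)%N -> digit_psum d m <= digit_psum d n.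
Proof.
move=> /subnK <-; elim: (n - m)%N => [|i IHi]; rewrite ?add0n// addSn.
by apply: le_trans IHi _; rewrite /digit_psum big_ord_recr/= lerDl divr_ge0.
Qed.

(** The partial sums increase, while adding to them a bound of the remainder
    makes them decrease. *)
Lemma digit_psum_le d m n :
  digit_psum d n <= digit_psum d m + 2 / 2 ^+ (m.+1 * m.+1).
Proof.
have [nm|/ltnW mn] := leqP n m.
  by rewrite (le_trans (digit_psum_ge d nm))// lerDl divr_ge0.
(* digits are at most 1 and consecutive bases have a quotient at least 2 *)
have step i : digit_psum d i.+1 + 2 / 2 ^+ (i.+2 * i.+2) <=
              digit_psum d i + 2 / 2 ^+ (i.+1 * i.+1).
  rewrite /digit_psum big_ord_recr/= -addrA lerD2l.
  rewrite (_ : i.+2 * i.+2 = i.+1 * i.+1 + (2 * i).+1.+2)%N; last by lia.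
  rewrite exprD invfM.
  set a := (2 ^+ (i.+1 * i.+1))^-1; set b := (2 ^+ _)^-1.
  have a0 : 0 <= a by rewrite invr_ge0 exprn_ge0.
  have b4 : b <= 4^-1.
    rewrite lef_pV2 ?posrE ?exprn_gt0//.
    rewrite (_ : 4 = 2 ^+ 2 :> R); last by lra.
    by rewrite ler_eXn2l ?ltr1n.
  have : a * b <= a * 4^-1 by rewrite ler_wpM2l.
  by case: (d i) => /=; lra.
suff : digit_psum d n + 2 / 2 ^+ (n.+1 * n.+1) <=
       digit_psum d m + 2 / 2 ^+ (m.+1 * m.+1).
  by apply: le_trans; rewrite lerDl divr_ge0.
rewrite -(subnK mn); elim: (n - m)%N => [|i IHi]; first by rewrite add0n.
by rewrite addSn; exact: le_trans (step _) IHi.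
Qed.

Lemma digit_sum_itv d n :
  digit_psum d n <= digit_sum d <= digit_psum d n + 2 / 2 ^+ (n.+1 * n.+1).
Proof.
apply/andP; split.
  apply: ub_le_sup; last by exists n.
  by exists (digit_psum d 0 + 2 / 2 ^+ (1 * 1)) => _ [m _ <-];
    exact: digit_psum_le.
apply: ge_sup; first by exists (digit_psum d 0), 0%N.
by move=> _ [m _ <-]; exact: digit_psum_le.
Qed.

Lemma digit_psum_int d k :
  exists z : int, 2 ^+ (k * k) * digit_psum d k = z%:~R.
Proof.
exists (\sum_(i < k) (d i)%:Z * 2 ^+ (k * k - i.+1 * i.+1)).
rewrite /digit_psum mulr_sumr rmorph_sum; apply: eq_bigr => i _ /=.
have le : (i.+1 * i.+1 <= k * k)%N by rewrite leq_mul.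
rewrite -{1}(subnK le) exprD rmorphM rmorphXn/= mulrCA.
by rewrite -mulrA divff ?mulr1// expf_neq0.
Qed.

(** The hypothesis on [k] excludes position 0, at which the digit 1 is half the
    quotient of consecutive bases, too large for the rounding. *)
Lemma digit_digit_sum d k : (0 < k)%N ->
  `|digit k (digit_sum d) - (d k)%:R| <= 2^-1 ^+ (2 * k).
Proof.
move=> k0; have [z zE] := digit_psum_int d k.
have := digit_sum_itv d k.+1.
rewrite {1 2}/digit_psum big_ord_recr/= -/(digit_psum d k).
set s := digit_sum d; set a := digit_psum d k => sE.
pose M : R := 2 ^+ (k * k); pose q : R := 2 ^+ (2 * k).+1.
have M0 : 0 < M by rewrite exprn_gt0.
have q0 : 0 < q by rewrite exprn_gt0.
have q8 : 8 <= q.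
  rewrite (_ : 8 = 2 ^+ 3); last by lra.
  by rewrite ler_eXn2l ?ltr1n//; lia.
have E1 : 2 ^+ (k.+1 * k.+1) = M * q :> R.
  by rewrite -exprD; congr (_ ^+ _); lia.
have E2 : 2 ^+ (k.+2 * k.+2) = M * (q * q * 4) :> R.
  rewrite (_ : 4 = 2 ^+ 2); last by lra.
  by rewrite -!exprD; congr (_ ^+ _); lia.
(* [u] is the part of [M * s] contributed by the digits from position [k] on *)
pose u := M * s - z%:~R.
have [lo hi] : (d k)%:R / q <= u /\ u <= (d k)%:R / q + 2 / (q * q * 4).
  rewrite /u -zE -/M -mulrBr -!(ler_pdivrMl _ _ M0) -!(ler_pdivlMl _ _ M0).
  rewrite E1 E2 in sE; move: sE.
  rewrite !invfM !mulrDr; set Mi := M^-1; set qi := q^-1.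
  by move=> /andP[]; rewrite -/a => lo hi; split; [move: lo|move: hi]; lra.
have qV : 0 < q^-1 <= 8^-1 by rewrite invr_gt0 q0 lef_pV2 ?posrE.
have err : 2 / (q * q * 4) = q^-1 * (q^-1 / 2) by rewrite !invfM; lra.
have errq : q^-1 * (q^-1 / 2) <= 8^-1 * (8^-1 / 2).
  by rewrite ler_pM// ?divr_ge0//; lra.
have err0 : 0 <= q^-1 * (q^-1 / 2) by rewrite mulr_ge0// ?divr_ge0//; lra.
have dE : 0 <= (d k)%:R / q <= 8^-1.
  by case: (d k) => /=; rewrite ?mul1r ?mul0r; lra.
rewrite /digit -/M -/q (cfrac_near (z := z)); last first.
  by rewrite -/u ltr_norml; lra.
rewrite -/u; have qE : q * ((d k)%:R / q) = (d k)%:R.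
  by rewrite mulrC divfK ?gt_eqF.
have : 0 <= q * (u - (d k)%:R / q) <= q^-1 / 2.
  rewrite mulr_ge0 ?subr_ge0 ?(ltW q0)//= -ler_pdivlMl//; lra.
rewrite mulrBr qE => /andP[ge0 le]; rewrite ger0_norm//.
apply: le_trans le _; apply: (le_trans (y := q^-1)); first by lra.
rewrite exprVn lef_pV2 ?posrE ?exprn_gt0// ler_eXn2l ?ltr1n//; lia.
Qed.

End Digits.

(** * Limsup of a translated sequence *)
Section LimsupShift.
Context {R : realType}.
Implicit Types u v : R^o^nat.

Lemma bounded_fun_norm_le u (C : R) : (forall n, `|u n| <= C) -> bounded_fun u.
Proof.
move=> uC; exists C; split; first exact: num_real.
by move=> M CM n _; exact: le_trans (uC n) (ltW CM).
Qed.

(** Subadditivity of the limsup, applied to [u + v] and to [(u + v) - v]. *)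
Lemma limn_supD_cvg u v (l : R) : bounded_fun u -> v @ \oo --> l ->
  limn_sup (u \+ v) = limn_sup u + l.
Proof.
move=> bu vl; have cv : cvgn v by apply/cvg_ex; exists l.
have bv : bounded_fun v := cvg_seq_bounded cv.
have vE : limn_sup v = l by case: (cvg_limn_inf_sup vl).
have [_ nvE] := cvg_limn_inf_sup (cvgN vl).
apply/eqP; rewrite eq_le -{1}vE le_limn_supD//=.
have := le_limn_supD (bounded_funD bu bv) (bounded_funN bv).
rewrite [X in _ <= _ + X -> _]nvE lerBrDr; apply: le_trans.
rewrite lerD2r (_ : (u + v) \+ - v = u)//.
by apply/funext => n /=; rewrite addrK.
Qed.

End LimsupShift.

(** * The group of reals with bounded digits *)
Section Blocks.
Context {R : realType}.
Implicit Types (t : nat -> nat -> bool) (k n : nat) (y p : R).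

Definition block_norm n y : R := \sum_(2 ^ n <= k < 2 ^ n.+1) `|digit k y|.

(** The set [Y] supporting the equations. *)
Definition bounded_digits : set R :=
  [set y | exists C : nat, forall n, block_norm n y <= C%:R].

Lemma measurable_block_norm n : measurable_fun [set: R] (block_norm n).
Proof.
apply: measurable_sum => k.
by apply: measurableT_comp; [exact: normr_measurable|exact: measurable_digit].
Qed.

Lemma measurable_bounded_digits : measurable bounded_digits.
Proof.
rewrite (_ : bounded_digits =
    \bigcup_(C in [set: nat]) \bigcap_(n in [set: nat])
    (block_norm n @^-1` `]-oo, C%:R])).
  apply: bigcupT_measurable => C; apply: bigcapT_measurable => n.
  by rewrite -[X in measurable X]setTI; exact: measurable_block_norm.
apply/seteqP; split=> y.
  by case=> C bC; exists C => // n _ /=; rewrite in_itv/= bC.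
by case=> C _ bC; exists C => n; have := bC n I; rewrite /= in_itv.
Qed.

Lemma bounded_digitsD y p :
  bounded_digits y -> bounded_digits p -> bounded_digits (y + p).
Proof.
move=> [B yB] [C pC]; exists (B + C)%N => n; rewrite natrD.
apply: le_trans (lerD (yB n) (pC n)); rewrite -big_split/=.
by apply: ler_sum => k _; exact: digitD_le.
Qed.

Lemma bounded_digitsN y : bounded_digits y -> bounded_digits (- y).
Proof.
move=> [C yC]; exists C => n; apply: le_trans (yC n).
by apply: ler_sum => k _; exact: digitN_le.
Qed.

(** Translations commute, hence the right-hand side of each equation must be
    compatible with the translations of the others; invariance ensures it. *)
Lemma indic_bounded_digitsD y p : bounded_digits p ->
  \1_bounded_digits (y + p) = \1_bounded_digits y :> R.
Proof.
move=> Yp; rewrite !indicE; congr (_%:R); congr nat_of_bool.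
apply/idP/idP; rewrite !inE => Yy.
  by rewrite -(addrK p y); apply: bounded_digitsD Yy _; exact: bounded_digitsN.
exact: bounded_digitsD.
Qed.

Definition block_sum t n y : R :=
  \sum_(2 ^ n <= k < 2 ^ n.+1) (t n k)%:R * digit k y.

Lemma measurable_block_sum t n : measurable_fun [set: R] (block_sum t n).
Proof.
by apply: measurable_sum => k; apply: measurable_funM => //;
  exact: measurable_digit.
Qed.

Lemma block_sum_le t n y : `|block_sum t n y| <= block_norm n y.
Proof.
apply: le_trans (ler_norm_sum _ _ _) _; apply: ler_sum => k _.
rewrite normrM ger0_norm//; case: (t n k); rewrite ?mul1r//.
by rewrite mul0r.
Qed.

Lemma digit_le_block_norm n k y : (2 ^ n <= k < 2 ^ n.+1)%N ->
  `|digit k y| <= block_norm n y.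
Proof.
move=> kn; rewrite /block_norm (bigD1_seq k) ?mem_index_iota ?iota_uniq//=.
by rewrite lerDl sumr_ge0.
Qed.

(** A digit of the block [n] is bounded by a constant, hence is small compared
    with [4 ^ k >= 4 ^ n] for large [n]. *)
Lemma block_sumD t y p : bounded_digits y -> bounded_digits p ->
  \forall n \near \oo,
    block_sum t n (y + p) = block_sum t n y + block_sum t n p.
Proof.
move=> [B yB] [C pC]; exists (B + C)%N => // n /= BCn.
rewrite -big_split/=; apply: eq_big_nat => k kn; rewrite -mulrDr digitD//.
apply: le_lt_trans
  (lerD (digit_le_block_norm _ kn) (digit_le_block_norm _ kn)) _.
apply: le_lt_trans (lerD (yB n) (pC n)) _.
rewrite -natrD -natrX ltr_nat; apply: leq_ltn_trans BCn _.
have /andP[nk _] := kn.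
have := ltn_expl n (isT : 1 < 2)%N; have := ltn_expl k (isT : 1 < 4)%N; lia.
Qed.

(** The weighted sums need not converge, and the limsup replaces a limit. The
    cutoff to [bounded_digits] keeps the sequence bounded. *)
Definition limsup_sum t y : R :=
  limn_sup (fun n => block_sum t n y * \1_bounded_digits y).

Lemma block_sum_indic_bounded t y : exists C : R, forall n,
  `|block_sum t n y * \1_bounded_digits y| <= C.
Proof.
have [[C yC]|nY] := pselect (bounded_digits y).
  exists C%:R => n; rewrite indicE mem_set ?mulr1; last by exists C.
  exact: le_trans (block_sum_le t n y) (yC n).
by exists 0 => n; rewrite indicE memNset// mulr0 normr0.
Qed.

Lemma measurable_limsup_sum t : measurable_fun [set: R] (limsup_sum t).
Proof.
apply: (measurable_fun_limn_sup
    (h := fun n y => block_sum t n y * \1_bounded_digits y)).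
- move=> y _; have [C yC] := block_sum_indic_bounded t y.
  by exists C => _ [n _ <-]; exact: le_trans (ler_norm _) (yC n).
- move=> y _; have [C yC] := block_sum_indic_bounded t y.
  exists (- C) => _ [n _ <-]; rewrite lerNl; apply: le_trans (yC n).
  by rewrite -normrN ler_norm.
- move=> n; apply: measurable_funM; first exact: measurable_block_sum.
  by apply: measurable_indic; exact: measurable_bounded_digits.
Qed.

(** The difference of the sequences at [y + p] and at [y] converges to [l],
    because the block sums are eventually additive. *)
Lemma limsup_sumD t y p (l : R) : bounded_digits p ->
    block_sum t ^~ p @ \oo --> l ->
  limsup_sum t (y + p) - limsup_sum t y = l * \1_bounded_digits y.
Proof.
move=> Yp pl; have [C yC] := block_sum_indic_bounded t y.
apply/eqP; rewrite subr_eq [eqbRHS]addrC /limsup_sum; apply/eqP.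
rewrite -(limn_supD_cvg (bounded_fun_norm_le yC) (v := fun n =>
  (block_sum t n (y + p) - block_sum t n y) * \1_bounded_digits y)).
  congr limn_sup; apply/funext => n /=.
  by rewrite indic_bounded_digitsD// -mulrDl subrKC.
rewrite indicE; have [|nYy] := boolP (y \in bounded_digits); last first.
  by rewrite !mulr0; under eq_cvg do rewrite mulr0; exact: cvg_cst.
rewrite inE => Yy; rewrite !mulr1; under eq_cvg do rewrite mulr1.
apply: cvg_trans pl; apply: near_eq_cvg.
near=> n; have -> : block_sum t n (y + p) = block_sum t n y + block_sum t n p.
  by near: n; exact: block_sumD.
by rewrite addrAC subrr add0r.
Unshelve. all: by end_near. Qed.

End Blocks.

(** * Real numbers attached to the branches of the binary tree *)
Section Branches.
Implicit Types (x : nat -> bool) (n k : nat).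

(** The node of the branch [x] at level [n], the nodes being numbered in
    breadth-first order from the root 1. *)
Fixpoint branch x n : nat :=
  if n is m.+1 then ((branch x m).*2 + x m)%N else 1.

Lemma branch_bounds x n : (2 ^ n <= branch x n < 2 ^ n.+1)%N.
Proof.
by elim: n => // n IHn; rewrite !expnS in IHn *; case: (x n) => /=; lia.
Qed.

Lemma branch_inj x y n : branch x n = branch y n ->
  forall i, (i < n)%N -> x i = y i.
Proof.
elim: n => // n IHn /= e i; rewrite ltnS leq_eqVlt => /orP[/eqP ->|].
  by move: e; case: (x n) (y n) => -[]//; lia.
by apply: IHn; move: e; case: (x n) (y n) => -[]; lia.
Qed.

Lemma branch_neq x y : x <> y -> \forall n \near \oo, branch x n <> branch y n.
Proof.
move=> xy; have [i xyi] : exists i, x i <> y i.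
  by apply: contrapT => noi; apply: xy; apply/funext => i;
    apply: contrapT => xyi; apply: noi; exists i.
by exists i.+1 => // n /= ni /branch_inj/(_ i ni).
Qed.

(** At level [n], a node receives the value prescribed by the first of the
    branches [j 0], ..., [j n] passing through it.  Once [n] is so large that
    [j i] is separated from the different ones among [j 0], ..., [j i], the
    first branch found at the node of [j i] is [j i] itself. *)
Lemma branch_interpolation (j : nat -> nat -> bool)
    (phi : (nat -> bool) -> bool) :
  exists t : nat -> nat -> bool, forall i,
    \forall n \near \oo, t n (branch (j i) n) = phi (j i).
Proof.
pose f n k := find (fun i => branch (j i) n == k) (iota 0 n.+1).
exists (fun n k => phi (j (f n k))) => i.
have sep : \forall n \near \oo, forall i', (i' < i.+1)%N ->
    branch (j i') n = branch (j i) n -> j i' = j i.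
  elim: (i.+1) => [|m IHm]; first by near=> n.
  have nem : \forall n \near \oo, branch (j m) n = branch (j i) n -> j m = j i.
    have [jmi|/branch_neq ne] := pselect (j m = j i); first by near=> n.
    by apply: filterS ne => n.
  near=> n => i'; rewrite ltnS leq_eqVlt => /orP[/eqP ->|]; first by near: n.
  by move: i'; near: n.
near=> n.
have hasi : has (fun i' => branch (j i') n == branch (j i) n) (iota 0 n.+1).
  apply/hasP; exists i => //; rewrite mem_iota/= add0n ltnS.
  by near: n; exists i.
have fi : (f n (branch (j i) n) <= i)%N.
  rewrite leqNgt; apply/negP => /(before_find 0%N).
  rewrite nth_iota ?add0n ?eqxx// ltnS.
  by near: n; exists i.
congr phi; move: (nth_find 0%N hasi).
rewrite -/(f n (branch (j i) n)) nth_iota ?add0n; last first.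
  by move: hasi; rewrite has_find size_iota.
by move=> /eqP; move: fi; rewrite -ltnS; move: (f _ _); near: n.
Unshelve. all: by end_near. Qed.

(** The logarithm is the level of the node [k]. *)
Definition branch_digits x k : bool := k == branch x (trunc_log 2 k).

Lemma branch_digitsE x n k : (2 ^ n <= k < 2 ^ n.+1)%N ->
  branch_digits x k = (k == branch x n).
Proof. by move=> kn; rewrite /branch_digits (trunc_log_eq _ kn). Qed.

Context {R : realType}.

Definition branch_real x : R := digit_sum (branch_digits x).

Lemma sum_branch_digits x n (F : nat -> R) :
  \sum_(2 ^ n <= k < 2 ^ n.+1) F k * (branch_digits x k)%:R = F (branch x n).
Proof.
rewrite (eq_big_nat _ _ (F2 := fun k => if k == branch x n then F k else 0)).
  by rewrite -big_mkcond big_nat1_eq branch_bounds.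
move=> k kn; rewrite (branch_digitsE x kn).
by case: eqP => _; rewrite ?mulr1 ?mulr0.
Qed.

(** Every digit is wrong by at most [4 ^- k], and [k >= 2 ^ n >= n] for each of
    the [2 ^ n] positions of the block. *)
Lemma branch_real_error x n :
  \sum_(2 ^ n <= k < 2 ^ n.+1)
    `|digit k (branch_real x) - (branch_digits x k)%:R| <= 2^-1 ^+ n.
Proof.
apply: (le_trans (y := \sum_(2 ^ n <= k < 2 ^ n.+1) 2^-1 ^+ (2 * n))).
  apply: ler_sum_nat => k /andP[nk _].
  have := ltn_expl n (isT : 1 < 2)%N => n2n.
  apply: le_trans (digit_digit_sum _ _) _; first by lia.
  by rewrite ler_wiXn2l ?invr_ge0 ?invf_le1 ?ler1n//; lia.
rewrite sumr_const_nat expnS (mul2n (2 ^ n)) -addnn addKn.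
rewrite (mul2n n) -addnn exprD -[leLHS]mulr_natl natrX mulrA -exprMn divff//.
by rewrite expr1n mul1r.
Qed.

Lemma bounded_digits_branch_real x : bounded_digits (branch_real x).
Proof.
exists 2%N => n.
apply: (le_trans (y := \sum_(2 ^ n <= k < 2 ^ n.+1)
    (`|digit k (branch_real x) - (branch_digits x k)%:R| +
     1 * (branch_digits x k)%:R))).
  apply: ler_sum => k _; rewrite mul1r -[X in _ + X]ger0_norm//.
  by apply: le_trans (ler_normD _ _); rewrite subrK.
rewrite big_split/= (sum_branch_digits x n (fun=> 1)).
rewrite (_ : 2%:R = 1 + 1) ?lerD2r; last by lra.
apply: le_trans (branch_real_error x n) _.
by rewrite exprn_ile1 ?invr_ge0 ?invf_le1 ?ler1n.
Qed.

Lemma block_sum_branch_real x (t : nat -> nat -> bool) (b : bool) :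
  (\forall n \near \oo, t n (branch x n) = b) ->
  block_sum t ^~ (branch_real x) @ \oo --> (b%:R : R).
Proof.
move=> tb; apply/cvgrPdist_le => e e0.
have half : `|2^-1 : R| < 1 by rewrite ger0_norm ?invr_ge0// invf_lt1// ltr1n.
have small := cvgr0_norm_le _ (cvg_expr half) _ e0.
apply: filterS2 tb (small _) => n {}tb; apply: le_trans.
rewrite [leRHS]ger0_norm ?exprn_ge0 ?invr_ge0//.
apply: le_trans (branch_real_error x n).
rewrite -tb -(sum_branch_digits x n (fun k => (t n k)%:R)) distrC -sumrB.
apply: le_trans (ler_norm_sum _ _ _) _; apply: ler_sum => k _.
rewrite -mulrBr normrM ger0_norm//.
by case: (t n k); rewrite ?mul1r ?mul0r.
Qed.

End Branches.

(** * Codes of Borel sets *)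
Inductive borel_code : Type :=
| CodeRay of rat
| CodeCompl of borel_code
| CodeUnion of (nat -> borel_code).

(** A code is a well-founded tree, with a child for each natural number at the
    nodes of countable unions. It is determined by its function from paths to
    labels: this shows that there are at most continuum many codes. A
    complement does not branch, and the letter read there is ignored. *)
Fixpoint code_label (c : borel_code) (w : seq nat) : nat :=
  match c, w with
  | CodeRay q, _ => (pickle q).+2
  | CodeCompl _, [::] => 0
  | CodeCompl c', _ :: w' => code_label c' w'
  | CodeUnion _, [::] => 1
  | CodeUnion F, n :: w' => code_label (F n) w'
  end.

Lemma code_label_inj : injective code_label.
Proof.
elim=> [q|c IHc|F IHF] [q'|c'|F'] e; have /= e0 := congr1 (@^~ [::]) e => //.
- by case: e0 => /(pcan_inj pickleK) ->.
- by congr CodeCompl; apply: IHc; apply/funext => w;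
    exact: (congr1 (@^~ (0 :: w)) e).
- congr CodeUnion; apply/funext => n; apply: IHF; apply/funext => w.
  exact: (congr1 (@^~ (n :: w)) e).
Qed.

Definition encode (c : borel_code) (m : nat) : bool :=
  if unpickle m is Some (w, l) then code_label c w == l else false.

Lemma encode_inj : injective encode.
Proof.
move=> c c' e; apply: code_label_inj; apply/funext => w; apply/esym/eqP.
have := congr1 (@^~ (pickle (w, code_label c w))) e.
by rewrite /encode pickleK eqxx => <-.
Qed.

Section Decoding.
Context {R : realType}.

Fixpoint decode (c : borel_code) : set R :=
  match c with
  | CodeRay q => `]ratr q, +oo[
  | CodeCompl c' => ~` decode c'
  | CodeUnion F => \bigcup_n decode (F n)
  end.

(** The sets with a code form a sigma-algebra containing the open right rays,
    every real being a limit of rationals from above. *)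
Lemma measurable_decode (A : set R) : measurable A -> exists c, decode c = A.
Proof.
rewrite [X in X A]RGenOInfty.measurableE.
apply: (smallest_sub (X := [set B | exists c, decode c = B])).
  split.
    (* the empty set as the complement of the union of a ray and of its
       complement *)
  - exists (CodeCompl (CodeUnion (fun m =>
      if m is 0 then CodeRay 0 else CodeCompl (CodeRay 0)))).
    rewrite -subset0 => x /=; apply.
    have [x0|x0] := pselect (decode (CodeRay 0) x); first by exists 0%N.
    by exists 1%N.
  - by move=> B [c <-]; exists (CodeCompl c); rewrite setTD.
  - move=> F /choice[g gF]; exists (CodeUnion g) => /=.
    by apply: eq_bigcupr => n _.
move=> _ [x ->].
have xlt : x < x + 1 by rewrite ltrDl.
(* [q0] fills the positions that do not number a rational above [x] *)
have [q0] := rat_in_itvoo xlt; rewrite in_itv/= => /andP[xq0 _].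
pose g m := if unpickle m is Some q then if x < ratr q then q else q0 else q0.
have xg m : x < ratr (g m) by rewrite /g; case: (unpickle m) => // q; case: ifP.
exists (CodeUnion (fun m => CodeRay (g m))).
apply/seteqP; split=> y.
  by move=> [m _]; rewrite /= !in_itv/= !andbT; exact: lt_trans.
rewrite /= in_itv/= andbT => /rat_in_itvoo[q]; rewrite in_itv/= => /andP[xq qy].
by exists (pickle q) => //; rewrite /g pickleK xq /= in_itv/= qy.
Qed.

End Decoding.

(** * The system of equations *)
Section System.
Context {R : realType}.

Definition diagonal (x : nat -> bool) : bool :=
  `[< exists2 c, encode c = x & ~ decode c (branch_real x : R) >].

(** If [c] codes the Borel set where [f - f 0 = 1], then the value of
    [diagonal] at [encode c] contradicts the equation there. *)
Lemma diagonal_not_borel (f : R -> R) : measurable_fun [set: R] f ->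
  ~ forall x, f (branch_real x) - f 0 = (diagonal x)%:R.
Proof.
move=> mf fE.
have [c cE] : exists c, decode c = [set y | f y - f 0 = 1].
  apply: measurable_decode.
  rewrite (_ : [set _ | _] = f @^-1` [set f 0 + 1]).
    by rewrite -[X in measurable X]setTI; exact: mf.
  by apply/seteqP; split=> y /=;
    [move=> <-; rewrite subrKC|move=> ->; rewrite addrC addKr].
have := fE (encode c); rewrite /diagonal.
case: asboolP => [[c' /encode_inj ->]|].
  by rewrite cE.
move=> nex fy; apply: nex; exists c => //.
by rewrite cE /= fy => /esym/eqP; rewrite oner_eq0.
Qed.

Definition shift_operator (p : R) (f : R -> R) (y : R) : R := f (y + p) - f y.

Lemma difference_shift_operator p : difference_operator (shift_operator p).
Proof.
exists 2%N, (fun i => if i == ord0 then 1 else -1),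
  (fun i => if i == ord0 then p else 0).
by move=> f x; rewrite big_ord_recl big_ord1/= mul1r mulN1r addr0.
Qed.

Definition branch_equation (x : nat -> bool) : equation R :=
  (shift_operator (branch_real x),
   fun y => (diagonal x)%:R * \1_bounded_digits y).

(** One choice of weights serves all the branches [j i]. *)
Lemma countable_solvable (j : nat -> nat -> bool) :
  exists2 f, borel_fun f &
    forall i, (branch_equation (j i)).1 f = (branch_equation (j i)).2.
Proof.
have [t tE] := branch_interpolation j diagonal.
exists (limsup_sum t); first exact: measurable_limsup_sum.
move=> i; apply/funext => y; apply: limsup_sumD.
  exact: bounded_digits_branch_real.
exact/block_sum_branch_real/tE.
Qed.

Lemma branch_system_countably_solvable (S : set (equation R)) :
  S `<=` range branch_equation -> countable S -> solvable_in (@borel_fun R) S.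
Proof.
move=> Sb /countable_injP[g injg].
have /choice[j jE] n : exists x,
    forall e, S e -> g e = n -> branch_equation x = e.
  have [[e Se ge]|nex] := pselect (exists2 e, S e & g e = n); last first.
    by exists xpred0 => e Se ge; case: nex; exists e.
  have [x _ xe] := Sb _ Se; exists x => e' Se' ge'.
  by rewrite xe; apply: injg; rewrite ?inE// ge'.
have [f bf fE] := countable_solvable j.
exists f => // D h SDh.
by have := fE (g (D, h)); rewrite (jE _ _ SDh erefl).
Qed.

Lemma branch_system_unsolvable :
  ~ solvable_in (@borel_fun R) (range branch_equation).
Proof.
move=> [f bf fE]; apply: (diagonal_not_borel bf) => x.
have := fE _ _ (ex_intro2 _ _ x I erefl).
move=> /(congr1 (@^~ 0)); rewrite /shift_operator add0r => ->.
have Y0 : bounded_digits (0 : R).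
  have Yx := bounded_digits_branch_real (R := R) x.
  by rewrite -(subrr (branch_real x));
    apply: bounded_digitsD Yx (bounded_digitsN Yx).
by rewrite indicE mem_set// mulr1.
Qed.

End System.

(** * The solvability cardinal *)
Lemma card_le_of_not_lt (T U : Type) :
  ~ ([set: T] #< [set: U]) -> [set: U] #<= [set: T].
Proof.
move=> nlt; have [TU|//] := card_le_total T U.
apply: contrapT => nUT; apply: nlt; split=> //.
by apply/negP; rewrite card_eq_le => /andP[_].
Qed.

(** An uncountable set has at least [omega 1] elements, by minimality of the
    successor cardinal. *)
Lemma countable_card_lt_omega1 T (A : set T) (K : Type) :
  [set: K] #<= [set: omega 1] -> A #< [set: K] -> countable A.
Proof.
move=> K1 [AK nAK]; have AT := card_setT A.
apply: contrapT => ncA; have [_ min1] := succ_cardP nat.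
have natA : [set: nat] #< [set: A].
  apply: contrapT => /card_le_of_not_lt; rewrite /countable.
  by rewrite (card_le_eql AT).
move: nAK; rewrite card_eq_le AK /= => /negP; apply.
rewrite -(card_le_eqr AT); exact: card_le_trans K1 (min1 _ natA).
Qed.

Theorem theorem6p2 (R : realType) :
  ([set: omega 2] #<= [set: sc (@borel_fun R)])%card.
Proof.
have [_ min2] := succ_cardP (omega 1); apply: min2.
apply: contrapT => /card_le_of_not_lt sc1.
have [prop _] := scP (@borel_fun R).
apply: (@branch_system_unsolvable R); apply: prop.
  by move=> _ [x _ <-]; exact: difference_shift_operator.
move=> S Sb Slt; apply: branch_system_countably_solvable Sb _.
exact: countable_card_lt_omega1 sc1 Slt.
Qed.
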